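(* Let $\bar t\in(0,\tfrac12)$, $B>0$, $\bar m_2>0$, $\kappa\ge0$, $\varepsilon\in\left(0,\min\left(\bar t,\tfrac1B\right)\right)$, and $F\in\mathcal{F}_{\bar t,B,\bar m_2,\kappa}$. Let the pairs $(Y_i,D_i)$, for $i\in[n]$, be drawn independently (across $i$) with marginals $Y_i\sim F$ and $D_i\sim\mathrm{Ber}(\varepsilon)$ ($Y_i$ and $D_i$ need not be independent of each other). Let $\{Z_i\}_{i\in[n]}$ be arbitrary random variables possibly depending on $\{Y_i,D_i\}_{i\in[n]}$, and define $X_i=(1-D_i)Y_i+D_iZ_i$. Then, for any confidence level $\delta>0$, any error level $E>0$, and any number of samples $$n\ge 2\max\left(\frac{16\kappa^2B^2\bar m_2^2}{E^2},\left(\min\left(\bar t,\tfrac1B\right)-\varepsilon\right)^{-2}\right)\log\frac6\delta,$$ we have $$\mathbb{P}\Big(\left|\hat m_2(X_1,\dots,X_n)-m_2(F)\right|\le(1+2\kappa)\,B\,m_2(F)\,\varepsilon+E\Big)\ge1-\delta .$$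
   Context: Distributions are on $\mathbb{R}$ and identified with their cdfs; $[n]=\{1,\dots,n\}$. For a cdf $F$, $Q_{L,F}(p)=\inf\{x:F(x)\ge p\}$ and $Q_{R,F}(p)=\inf\{x:F(x)>p\}$. For $X\sim F$: $m_1(F)$ is the median of $F$ (when unique), $m_2(F)$ is the median of $|X-m_1(F)|$ (the median absolute deviation, MAD), and, when $m_2(F)$ is unique, $m_4(F)$ is the median of $\big||X-m_1(F)|-m_2(F)\big|$. The empirical median $\hat m_1(x_1,\dots,x_n)$ is the middle value if $n$ is odd and the average of the two middle values if $n$ is even; the empirical MAD is $\hat m_2(x_1,\dots,x_n)=\hat m_1(|x_1-\hat m|,\dots,|x_n-\hat m|)$ with $\hat m=\hat m_1(x_1,\dots,x_n)$. For $\bar t\in(0,\tfrac12)$, $B>0$, $\bar m_2>0$, $\kappa\ge0$, $\mathcal{F}_{\bar t,B,\bar m_2,\kappa}$ is the family of distributions $F$ with unique $m_1(F),m_2(F),m_4(F)$ such that: (i) $|F(x_1)-F(x_2)|\ge\frac{1}{B\,m_2(F)}|x_1-x_2|$ for all $x_1,x_2\in\left[Q_{L,F}(\tfrac12-\bar t),Q_{R,F}(\tfrac12+\bar t)\right]\cup\left[m_1(F)-2m_2(F),m_1(F)+2m_2(F)\right]$; (ii) $m_2(F)\le\bar m_2$; (iii) $m_2(F)\le\kappa\,m_4(F)$. *)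

(* Defs.v *)
(* MathComp-Analysis; the real numbers are an arbitrary R : realType. *)
From HB Require Import structures.
From mathcomp Require Import all_boot all_order all_algebra.
From mathcomp Require Import all_classical all_reals all_analysis.

Set Implicit Arguments.
Unset Strict Implicit.
Unset Printing Implicit Defensive.

Import Order.TTheory GRing.Theory Num.Theory.
Import numFieldNormedType.Exports.

Local Open Scope classical_set_scope.
Local Open Scope ring_scope.

Section MedianOfDistribution.
Context (R : realType) (F : probability (measurableTypeR R) R).

Definition cdfF (x : R) : R := fine (F `]-oo, x]%classic).

Definition quantileL (p : R) : R := inf [set x | p <= cdfF x].

Definition quantileR (p : R) : R := inf [set x | p < cdfF x].

(* [m] is a median of [f X], where X ~ F. *)
Definition is_median (f : R -> R) (m : R) : Prop :=
  ((2^-1)%:E <= F [set x | (f x <= m)%R])%E /\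
  ((2^-1)%:E <= F [set x | (m <= f x)%R])%E.

Definition has_unique_median (f : R -> R) : Prop := exists! m, is_median f m.

(* Some median of [f X]; the median when it is unique. *)
Definition median (f : R -> R) : R := xget 0 [set m | is_median f m].

Definition m1 : R := median id.

Definition m2 : R := median (fun x => `|x - m1|).

Definition m4 : R := median (fun x => `| `|x - m1| - m2 |).

(* The lower bound on the increments of the cdf divides by m2, hence the
   field m2_gt0: MathComp's convention 0^-1 = 0 would otherwise make that bound
   vacuous for distributions with m2 = 0. *)
Record mad_family (tbar B m2bar kappa : R) : Prop := MadFamily {
  m1_unique : has_unique_median id;
  m2_unique : has_unique_median (fun x => `|x - m1|);
  m4_unique : has_unique_median (fun x => `| `|x - m1| - m2 |);
  m2_gt0 : 0 < m2;
  cdf_increments : forall x1 x2 : R,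
    let I := `[quantileL (2^-1 - tbar), quantileR (2^-1 + tbar)]%classic
             `|` `[m1 - 2 * m2, m1 + 2 * m2]%classic in
    I x1 -> I x2 ->
    (B * m2)^-1 * `|x1 - x2| <= `|cdfF x1 - cdfF x2|;
  m2_le : m2 <= m2bar;
  m2_le_m4 : m2 <= kappa * m4 }.

End MedianOfDistribution.

Section EmpiricalMedian.
Context (R : realType).

Definition emp_median (s : seq R) : R :=
  let s' := sort <=%R s in
  if odd (size s) then s'`_(size s)./2
  else (s'`_(size s)./2.-1 + s'`_(size s)./2) / 2.

Definition emp_mad (s : seq R) : R :=
  emp_median [seq `|x - emp_median s| | x <- s].

End EmpiricalMedian.

Definition mutually_independent d d' (T : measurableType d)
    (T' : measurableType d') (R : realType) (P : probability T R)
    (I : finType) (V : I -> T -> T') : Prop :=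
  forall (J : {set I}) (A : I -> set T'), (forall i, measurable (A i)) ->
    P (\bigcap_(i in [set` J]) (V i @^-1` A i)) =
    (\prod_(i in J) P (V i @^-1` A i))%E.

(* Equality of measures is only required on measurable sets: the values of a
   MathComp-Analysis measure elsewhere are meaningless. *)
Definition has_law d d' (T : measurableType d) (T' : measurableType d')
    (R : realType) (P : probability T R) (V : {RV P >-> T'})
    (mu : probability T' R) : Prop :=
  forall A : set T', measurable A -> distribution P V A = mu A.

(* Main.v *)
(* Put s = min(E / (4 kappa B m2bar), min(tbar, 1/B) - eps) and
   a = B m2 (eps + s), so that a <= m2.  Each of the four events Y > m1 + a,
   Y < m1 - a, |Y - m1| > m2 + a, |Y - m1| < m2 - a has F-probability at most
   1/2 - a / (B m2) = 1/2 - (eps + s): it misses an interval of length a on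
   which the increments of the cdf are bounded below.  Adding the event D = 1
   costs eps, so that a Chernoff bound shows that, outside probability
   4 (delta/6), none of the four events, so enlarged, occurs for half of the
   samples.  Then the empirical median is within a of m1, and the empirical MAD
   is within 2a = 2 B m2 eps + 2 B m2 s of m2.  Since m4 <= m2 always holds,
   (iii) forces kappa >= 1, and 2a is below the required error. *)
Require Import Defs.
From HB Require Import structures.
From mathcomp Require Import all_boot all_order all_algebra.
From mathcomp Require Import all_classical all_reals all_analysis.
From mathcomp Require Import measurable_realfun.
From mathcomp Require Import ring lra zify.

Set Implicit Arguments.
Unset Strict Implicit.
Unset Printing Implicit Defensive.

Import Order.TTheory GRing.Theory Num.Theory.
Import numFieldNormedType.Exports.

Local Open Scope classical_set_scope.
Local Open Scope ring_scope.

(** * Occurrence patterns of finitely many events *)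

Definition hits (I : finType) (T : Type) (A : I -> set T) (w : T) : {set I} :=
  finset (fun i => `[< A i w >]).

Lemma hits_in_bigcup (I : finType) (T : Type) (A : I -> set T)
    (Q : {pred {set I}}) :
  [set w | hits A w \in Q] =
  \bigcup_(J in [set` Q]) [set w | hits A w = J].
Proof.
apply/seteqP; split=> [w /= Qw|w [J /= QJ ->]] //.
by exists (hits A w).
Qed.

(** An exact pattern prescribes each event or its complement; this is the form to which mutual
    independence applies. *)
Lemma hits_eq_bigcap (I : finType) (T : Type) (A : I -> set T) (J : {set I}) :
  [set w | hits A w = J] =
  \bigcap_(i in [set` [set: I]%SET]) (if i \in J then A i else ~` A i).
Proof.
apply/seteqP; split=> [w /= <- i _|w hw /=].
  by rewrite inE; case: asboolP.
apply/setP => i; rewrite inE; have := hw i (finset.in_setT i).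
by case: ifPn => _ h; [apply/asboolT|apply/asboolF].
Qed.

Section HitsMeasurable.
Context (d : measure_display) (T : measurableType d) (I : finType).

Lemma measurable_hits_eq (A : I -> set T) (J : {set I}) :
  (forall i, measurable (A i)) -> measurable [set w | hits A w = J].
Proof.
move=> mA; rewrite hits_eq_bigcap; apply: fin_bigcap_measurable => // i _.
by case: ifP => _ //; exact: measurableC.
Qed.

Lemma measurable_hits_in (A : I -> set T) (Q : {pred {set I}}) :
  (forall i, measurable (A i)) -> measurable [set w | hits A w \in Q].
Proof.
move=> mA; rewrite hits_in_bigcup; apply: fin_bigcup_measurable => // J _.
exact: measurable_hits_eq.
Qed.

Lemma prob_hits_in (R : realType) (P : probability T R) (A : I -> set T)
    (Q : {pred {set I}}) : (forall i, measurable (A i)) ->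
  P [set w | hits A w \in Q] =
  (\sum_(J in Q) P [set w | hits A w = J])%E.
Proof.
move=> mA; rewrite hits_in_bigcup measure_fin_bigcup //.
- rewrite (@fsbigE _ _ _ _ _ (enum Q)) ?enum_uniq //.
  + rewrite big_enum_cond; apply: eq_bigl => J.
    by rewrite mem_setE andbC; case: (J \in Q).
  + by move=> J /=; rewrite mem_enum.
  + by move=> J QJ; rewrite mem_enum QJ.
- by move=> J1 J2 _ _ [w [/= <- <-]].
- by move=> J _; exact: measurable_hits_eq.
Qed.

End HitsMeasurable.

(** * Chernoff bound for a majority of independent events *)

(* Chernoff's argument with base 1 + 2s instead of the optimal
   sqrt((1/2 + s) / (1/2 - s)): this rational choice already gives
   Hoeffding's exponent. *)
Lemma sum_majority_le (R : realType) (I : finType) (p : I -> R) (s : R) :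
  0 <= s -> (forall i, 0 <= p i <= 2^-1 - s) ->
  \sum_(J : {set I} | (#|I| <= #|J|.*2)%N)
     \prod_i (if i \in J then p i else 1 - p i) <=
  expR (- 2 * s ^+ 2 * #|I|%:R).
Proof.
move=> s0 hp; pose rho := 1 + 2 * s.
have rho1 : 1 <= rho by rewrite /rho; lra.
have rho0 : 0 < rho by lra.
have q0 i (J : {set I}) : 0 <= (if i \in J then p i else 1 - p i).
  by have := hp i; case: ifP => _; lra.
(* Tilting multiplies the weight of [J] by [rho] to the power [#|J| - (#|I| - #|J|)], which is at
   least 1 as soon as [J] contains half of the indices. *)
have tilt (J : {set I}) :
    \prod_i (if i \in J then rho * p i else rho^-1 * (1 - p i)) =
    rho ^+ #|J| * rho^-1 ^+ (#|I| - #|J|) *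
    \prod_i (if i \in J then p i else 1 - p i).
  rewrite (bigID (mem J)) [X in _ = _ * X](bigID (mem J)) /=.
  rewrite [X in X * _](eq_bigr (fun i => rho * p i)); last by move=> i ->.
  rewrite [X in _ * X](eq_bigr (fun i => rho^-1 * (1 - p i))); last first.
    by move=> i /negbTE ->.
  rewrite [in RHS](eq_bigr p); last by move=> i ->.
  rewrite [X in _ = _ * (_ * X)](eq_bigr (fun i => 1 - p i)); last first.
    by move=> i /negbTE ->.
  rewrite !big_split /= !prodr_const -(cardC J) addKn.
  by rewrite mulrACA.
apply: (@le_trans _ _ (\sum_(J : {set I})
    \prod_i (if i \in J then rho * p i else rho^-1 * (1 - p i)))).
  rewrite big_mkcond /=; apply: ler_sum => J _; rewrite tilt.
  have w0 : 0 <= \prod_i (if i \in J then p i else 1 - p i).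
    by apply: prodr_ge0 => i _.
  case: ifP => hJ; last first.
    by rewrite !mulr_ge0 // exprn_ge0 // ?invr_ge0 ltW.
  rewrite -[leLHS]mul1r ler_wpM2r // exprVn.
  rewrite -ler_pdivrMr ?invr_gt0 ?exprn_gt0 //.
  by rewrite mul1r invrK ler_weXn2l // leq_subLR addnn.
(* The sum over all patterns is now unrestricted, so it factors into a product over the indices of
   [rho * p i + rho^-1 * (1 - p i)]. *)
rewrite -bigA_distr /=.
have -> : - 2 * s ^+ 2 * #|I|%:R = #|I|%:R * (- 2 * s ^+ 2) by rewrite mulrC.
rewrite expRM_natl -prodr_const; apply: ler_prod => i _.
have rhos : rho^-1 * (2^-1 + s) = 2^-1.
  have -> : 2^-1 + s = rho * 2^-1 by rewrite /rho; field.
  by rewrite mulKf // gt_eqF.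
have rV : rho^-1 <= 1 by rewrite invf_le1.
have rV0 : 0 < rho^-1 by rewrite invr_gt0.
have /andP[pi0 pi1] := hp i.
apply/andP; split.
  by rewrite addr_ge0 // mulr_ge0 ?(ltW rho0) ?(ltW rV0) //; lra.
apply: le_trans (expR_ge1Dx _).
(* Each factor is nondecreasing in [p i], hence largest at [p i = 1/2 - s]. There
   [rho * (1/2 - s) = 1/2 - 2 s^2] and, by [rhos], the other term is [1/2]: the sum is
   [1 - 2 s^2]. *)
have : 0 <= (rho - rho^-1) * (2^-1 - s - p i).
  by rewrite mulr_ge0 // subr_ge0 // (le_trans rV).
rewrite /rho in rhos *; set r := (1 + _)^-1 in rhos *; nra.
Qed.

(** Independence allows a different measurable set at each index, so choosing [A] or its complement
    gives every exact pattern a product probability; the majority patterns are then summed. *)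
Lemma prob_majority_le (d d' : measure_display) (T : measurableType d)
    (T' : measurableType d') (R : realType) (P : probability T R)
    (I : finType) (V : I -> T -> T') (A : set T') (s : R) :
  mutually_independent P V -> (forall i, measurable_fun [set: T] (V i)) ->
  measurable A -> 0 <= s ->
  (forall i, (P (V i @^-1` A) <= (2^-1 - s)%:E)%E) ->
  (P [set w | (#|I| <= #|hits (fun i => V i @^-1` A) w|.*2)%N] <=
   (expR (- 2 * s ^+ 2 * #|I|%:R))%:E)%E.
Proof.
move=> indV mV mA s0 hA.
have mVA i : measurable (V i @^-1` A).
  by rewrite -[X in measurable X]setTI; exact: mV.
pose p i := fine (P (V i @^-1` A)).
have pE i : P (V i @^-1` A) = (p i)%:E by rewrite fineK // fin_num_measure.
have p01 i : 0 <= p i <= 2^-1 - s.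
  by rewrite -!lee_fin -pE hA andbT.
rewrite (prob_hits_in P [pred J : {set I} | (#|I| <= #|J|.*2)%N]) //.
apply: le_trans (_ : ((\sum_(J : {set I} | (#|I| <= #|J|.*2)%N)
   \prod_i (if i \in J then p i else 1 - p i))%:E <= _)%E); last first.
  by rewrite lee_fin; exact: sum_majority_le.
rewrite -sumEFin; apply: lee_sum => J _.
have -> : [set w | hits (fun i => V i @^-1` A) w = J] =
  \bigcap_(i in [set` [set: I]%SET])
     (V i @^-1` (if i \in J then A else ~` A)).
  by rewrite hits_eq_bigcap; apply: eq_bigcapr => i _; case: ifP.
rewrite indV; last by move=> i; case: ifP => _ //; exact: measurableC.
rewrite le_eqVlt; apply/orP; left; apply/eqP.
rewrite -prodEFin; apply: eq_big => [i|i _]; first by rewrite finset.in_setT.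
case: ifP => _; first exact: pE.
have -> : V i @^-1` (~` A) = ~` (V i @^-1` A) by [].
by rewrite probability_setC // pE.
Qed.

(** * Order statistics and the empirical median through counting *)

Section EmpiricalMedian.
Context (R : realType).
Implicit Types (s : seq R) (v t : R) (k : nat).

(** Indices start at 0, hence the strict inequality. This trades sorting for counting, which is what
    makes order statistics measurable below. *)
Lemma nth_sort_le s k t : (k < size s)%N ->
  ((sort <=%R s)`_k <= t) = (k < count (fun x => (x <= t)%R) s)%N.
Proof.
move=> ks; have ss := sort_le_sorted s.
apply/idP/idP => [|kt]; last by apply: nth_count_le; rewrite ?count_sort.
apply: contraTT; rewrite -leqNgt -ltNge => ct.
by apply: nth_count_gt; rewrite ?count_sort ?size_sort // ct.
Qed.

(** Fewer than half of the entries exceed [v], so every sorted entry up to index [(size s)./2] is at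
    most [v]; this covers both parities. *)
Lemma emp_median_le s v :
  ((count (fun x => (v < x)%R) s).*2 < size s)%N -> emp_median s <= v.
Proof.
move=> h.
have hc : (count (fun x => (x <= v)%R) s +
           count (fun x => (v < x)%R) s = size s)%N.
  rewrite -(count_predC (fun x => x <= v)); congr addn.
  by apply: eq_count => x; rewrite /= ltNge.
move: hc h; set a := count _ _; set b := count _ _ => hc h.
have nthv k : (k <= (size s)./2)%N -> (sort <=%R s)`_k <= v.
  by move=> hk; rewrite nth_sort_le -?/a; lia.
rewrite /emp_median; case: ifP => _; first exact: nthv.
rewrite ler_pdivrMr // mulr_natr mulr2n lerD ?nthv //; lia.
Qed.

Lemma emp_median_ge s v :
  ((count (fun x => (x < v)%R) s).*2 < size s)%N -> v <= emp_median s.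
Proof.
move=> h.
(* The condition on [k] still admits the lower middle index [(size s)./2.-1] when the size is
   even. *)
have nthv k : (size s <= k.+1.*2)%N -> (k < size s)%N -> v <= (sort <=%R s)`_k.
  move=> nk ks; apply: nth_count_ge; first exact: sort_le_sorted.
  rewrite count_sort size_sort ks andbT -ltnS -ltn_double.
  exact: leq_trans h nk.
(* Nonemptiness prevents the predecessor in the lower middle index from truncating at 0. *)
have s0 : (0 < size s)%N by exact: leq_ltn_trans h.
have := odd_double_half (size s); clear h.
rewrite /emp_median; case: ifPn => os hs; first by apply: nthv; lia.
rewrite ler_pdivlMr // mulr_natr mulr2n lerD ?nthv //; lia.
Qed.

Lemma count_image (I : finType) (f : I -> R) (p : pred R) :
  count p [seq f i | i : I] = #|[pred i | p (f i)]|.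
Proof.
rewrite count_map count_filter cardE /enum_mem size_filter -enumT.
by apply: eq_count => i; rewrite /= andbT.
Qed.

End EmpiricalMedian.

(** * Measurability of the empirical median *)

Lemma measurable_set_bool (d : measure_display) (T : measurableType d)
    (f : T -> bool) :
  measurable_fun [set: T] f -> measurable [set w | f w].
Proof.
move=> mf; rewrite -[X in measurable X]setTI.
exact: (mf measurableT [set true]).
Qed.

Section EmpiricalMedianMeasurable.
Context (d : measure_display) (T : measurableType d) (R : realType).
Context (I : finType) (X : I -> T -> R).
Hypothesis mX : forall i, measurable_fun [set: T] (X i).

Lemma measurable_nth_sort k :
  measurable_fun [set: T] (fun w => (sort <=%R [seq X i w | i : I])`_k).
Proof.
(* Beyond the length of the list, [nth] returns its default 0, so the function is constant. *)
have [kI|Ik] := ltnP k #|I|; last first.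
  rewrite (_ : (fun w => _) = cst 0); first exact: measurable_cst.
  by apply/funext => w; rewrite nth_default // size_sort size_image.
apply: (measurability (@RGenOInfty.G R)) => [|/= _ [_] [t] -> <-].
  exact: RGenOInfty.measurableE.
(* The complement of the preimage of an open upper ray says that more than [k] of the variables are
   at most [t], an event on the pattern of hits. *)
rewrite setTI -[X in measurable X]setCK; apply: measurableC.
rewrite (_ : ~` _ = [set w | hits (fun i => [set w | X i w <= t]) w
                            \in [pred J : {set I} | (k < #|J|)%N]]).
  apply: measurable_hits_in => i; apply: measurable_set_bool.
  exact: measurable_fun_ler.
apply/funext => w; apply/propext => /=.
rewrite in_itv /= andbT inE.
have -> : #|hits (fun i => [set w | X i w <= t]) w| =
          count (fun x => x <= t) [seq X i w | i : I].
  by rewrite count_image; apply: eq_card => i; rewrite !inE asboolb.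
rewrite -nth_sort_le ?size_image //.
by split => [/negP|h]; [rewrite -leNgt|apply/negP; rewrite -leNgt].
Qed.

Lemma measurable_emp_median :
  measurable_fun [set: T] (fun w => emp_median [seq X i w | i : I]).
Proof.
pose st k w := (sort <=%R [seq X i w | i : I])`_k.
have mst k : measurable_fun [set: T] (st k) by exact: measurable_nth_sort.
rewrite (_ : (fun w => _) = fun w => if odd #|I| then st #|I|./2 w
                            else (st #|I|./2.-1 w + st #|I|./2 w) / 2).
  case: (odd #|I|); first exact: mst.
  by apply: measurable_funM => //; apply: measurable_funD; exact: mst.
by apply/funext => w; rewrite /emp_median size_image.
Qed.

End EmpiricalMedianMeasurable.

(** * Deterministic stability of the empirical MAD *)

(** The first two counts place the empirical median within [a] of [m]. Recentering there moves each
    absolute deviation by at most [a], so the last two counts control the empirical MAD up to a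
    second [a]. *)
Lemma emp_mad_close (R : realType) (I : finType) (x : I -> R) (m M a : R) :
  ((#|[pred i | (m + a < x i)%R]|.*2 < #|I|)%N) ->
  ((#|[pred i | (x i < m - a)%R]|.*2 < #|I|)%N) ->
  ((#|[pred i | (M + a < `|x i - m|)%R]|.*2 < #|I|)%N) ->
  ((#|[pred i | (`|x i - m| < M - a)%R]|.*2 < #|I|)%N) ->
  `|emp_mad [seq x i | i : I] - M| <= 2 * a.
Proof.
move=> h1 h2 h3 h4; rewrite /emp_mad; set em := emp_median [seq x i | i : I].
have em_le : em <= m + a.
  by apply: emp_median_le; rewrite count_image size_image.
have em_ge : m - a <= em.
  by apply: emp_median_ge; rewrite count_image size_image.
have em_close : `|em - m| <= a by rewrite ler_norml; apply/andP; lra.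
have -> : [seq `|y - em| | y <- [seq x i | i : I]] = [seq `|x i - em| | i : I].
  by rewrite -map_comp.
have dist_shift i : `| `|x i - em| - `|x i - m| | <= a.
  apply: le_trans (ler_dist_dist _ _) _; apply: le_trans em_close.
  by rewrite distrC (_ : x i - m - _ = em - m) //; ring.
rewrite ler_norml; apply/andP; split.
  rewrite lerBrDl; apply: emp_median_ge; rewrite count_image size_image.
  apply: leq_ltn_trans h4; rewrite leq_double; apply: subset_leq_card.
  apply/fintype.subsetP => i; rewrite !inE => hi.
  by have := dist_shift i; rewrite ler_norml; lra.
rewrite lerBlDl; apply: emp_median_le; rewrite count_image size_image.
apply: leq_ltn_trans h3; rewrite leq_double; apply: subset_leq_card.
apply/fintype.subsetP => i; rewrite !inE => hi.
by have := dist_shift i; rewrite ler_norml; lra.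
Qed.

(** * Mass near and beyond a median of a distribution *)

Section MedianTails.
Context (R : realType) (F : probability (measurableTypeR R) R).
Implicit Types (f : R -> R) (m x y : R).

Lemma median_is_median f : has_unique_median F f -> is_median F f (median F f).
Proof. by move=> [m [fm _]]; apply: (xgetPex 0); exists m. Qed.

Lemma is_median_gt f m : measurable_fun [set: R] f -> is_median F f m ->
  (F [set x | (m < f x)%R] <= (2^-1)%:E)%E.
Proof.
move=> mf [h _]; have mle : measurable [set x | f x <= m].
  by apply: measurable_set_bool; exact: measurable_fun_ler.
have -> : [set x | m < f x] = ~` [set x | f x <= m].
  by apply/funext => x; apply/propext; rewrite /= ltNge; split => /negP.
rewrite probability_setC // leeBlDr ?fin_num_measure //.
by apply: le_trans (leeD2l _ h); rewrite -EFinD lee_fin; lra.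
Qed.

Lemma is_median_lt f m : measurable_fun [set: R] f -> is_median F f m ->
  (F [set x | (f x < m)%R] <= (2^-1)%:E)%E.
Proof.
move=> mf [_ h]; have mge : measurable [set x | m <= f x].
  by apply: measurable_set_bool; exact: measurable_fun_ler.
have -> : [set x | f x < m] = ~` [set x | m <= f x].
  by apply/funext => x; apply/propext; rewrite /= ltNge; split => /negP.
rewrite probability_setC // leeBlDr ?fin_num_measure //.
by apply: le_trans (leeD2l _ h); rewrite -EFinD lee_fin; lra.
Qed.

(** Meant for [C] the region strictly beyond a median, of mass at most one half, and [G] a stretch
    of it that the tail [A] avoids. *)
Lemma prob_tail_le (A G C : set R) (c q : R) :
  measurable A -> measurable G -> measurable C ->
  A `&` G = set0 -> A `|` G `<=` C ->
  (F C <= c%:E)%E -> (q%:E <= F G)%E -> (F A <= (c - q)%:E)%E.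
Proof.
move=> mA mG mC AG AGC FC FG.
rewrite EFinB leeBrDr //; apply: le_trans FC.
apply: le_trans (le_measure F _ _ AGC); rewrite ?inE //;
  last exact: measurableU.
by rewrite measureU // leeD2l.
Qed.

Lemma cdf_itv x y : x <= y -> cdfF F y - cdfF F x = fine (F `]x, y]%classic).
Proof.
move=> xy.
have fF A : measurable A -> F A \is a fin_num by exact: fin_num_measure.
apply/eqP; rewrite subr_eq addrC /cdfF -fineD ?fF //.
rewrite -measureU //; last first.
  apply/seteqP; split => z //= []; rewrite !in_itv /= => zx /andP[xz _].
  by move: zx; rewrite leNgt xz.
by rewrite -itv_bndbnd_setU // bnd_simp.
Qed.

(** Increments of the cdf measure half-open intervals, and [y] may carry an atom; the open interval
    is therefore reached through []x, z]] with [z < y]. *)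
Lemma prob_itvoo_ge (c x y : R) : 0 < c -> x < y ->
  (forall z, x < z < y -> c * `|x - z| <= `|cdfF F x - cdfF F z|) ->
  ((c * (y - x))%:E <= F `]x, y[%classic)%E.
Proof.
move=> c0 xy hc; have mxy : measurable `]x, y[%classic by exact: measurable_itv.
rewrite -[F _]fineK ?fin_num_measure // lee_fin leNgt; apply/negP.
set q := fine _ => hq; have q0 : 0 <= q by exact: fine_ge0.
(* At [z0] the lower bound [c * (z0 - x)] equals [q]. The midpoint [z] of [z0] and [y] pushes it
   strictly above [q], although []x, z]] lies inside the interval of mass [q]. *)
pose z0 := x + q / c; pose z := (z0 + y) / 2.
have cz0 : c * (z0 - x) = q by rewrite /z0; field; rewrite gt_eqF.
have z0x : x <= z0 by rewrite lerDl divr_ge0 // ltW.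
have z0y : z0 < y by rewrite -(ltrD2r (- x)) -(ltr_pM2l c0) cz0.
have /hc : x < z < y by rewrite /z; apply/andP; lra.
have xz : x < z by rewrite /z; lra.
rewrite distrC gtr0_norm ?subr_gt0 // distrC cdf_itv ?(ltW xz) //.
rewrite ger0_norm ?fine_ge0 // => hz.
have : fine (F `]x, z]%classic) <= q.
  apply: fine_le; rewrite ?fin_num_measure //.
  apply: le_measure; rewrite ?inE // => u /=; rewrite !in_itv /=.
  by rewrite /z; lra.
have : c * (z0 - x) < c * (z - x) by rewrite ltr_pM2l // /z; lra.
lra.
Qed.

End MedianTails.

(** * Consequences of membership in the family: [kappa >= 1] and the four tails *)

Section MadFamily.
Context (R : realType) (tbar B m2bar kappa : R).
Context (F : probability (measurableTypeR R) R).
Hypothesis hB : 0 < B.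
Hypothesis hF : mad_family F tbar B m2bar kappa.

Let m1 := m1 F.
Let m2 := m2 F.

Lemma measurable_dist (u : R) : measurable_fun [set: R] (fun x : R => `|x - u|).
Proof. by apply: measurableT_comp => //; exact: measurable_funB. Qed.

(** Where [|x - m1| <= m2], the deviation [v x] is at most [m2], so [v <= m2] has mass at least one
    half. If [m4] exceeded [m2], then [v >= m2] would too, making [m2] a second median of [v]. *)
Lemma m4_le_m2 : m4 F <= m2.
Proof.
pose v (x : R) : R := `| `|x - m1| - m2|.
have mv : measurable_fun [set: R] v.
  apply: measurableT_comp => //; apply: measurable_funB => //.
  exact: measurable_dist.
have mset (f g : R -> R) : measurable_fun [set: R] f ->
    measurable_fun [set: R] g -> measurable [set x | f x <= g x].
  by move=> mf mg; apply: measurable_set_bool; exact: measurable_fun_ler.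
have [med_le _] : is_median F (fun x => `|x - m1|) m2.
  exact: median_is_median (m2_unique hF).
have [_ v_ge] : is_median F v (m4 F) by exact: median_is_median (m4_unique hF).
rewrite leNgt; apply/negP => lt24.
have med2 : is_median F v m2.
  split.
    apply: le_trans med_le _; apply: le_measure; rewrite ?inE.
    - by apply: mset => //; exact: measurable_dist.
    - exact: mset.
    - move=> x /= h.
      by have := normr_ge0 (x - m1); rewrite /v ler_norml; lra.
  apply: le_trans v_ge _; apply: le_measure; rewrite ?inE.
  - exact: mset.
  - exact: mset.
  - by move=> x /=; apply: le_trans; exact: ltW.
have [m [_ uniq_m]] := m4_unique hF.
have := uniq_m _ (median_is_median (m4_unique hF)).
rewrite (uniq_m _ med2) => m4E.
by move: lt24; rewrite /m4 -m4E ltxx.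
Qed.

(** As the median of a nonnegative variable, [m4] is nonnegative, and [0 < m2 <= kappa * m4] rules
    out 0. With [kappa < 1] one would get [m2 <= kappa * m4 < m4 <= m2]. *)
Lemma kappa_ge1 : 1 <= kappa.
Proof.
have m20 : 0 < m2 := m2_gt0 hF.
have h : m2 <= kappa * m4 F := m2_le_m4 hF.
have m40 : 0 <= m4 F.
  rewrite leNgt; apply/negP => m4_lt0.
  have [le_med _] := median_is_median (m4_unique hF); move: le_med.
  set S := [set x | _]; have -> : S = set0; last first.
    by rewrite measure0 lee_fin leNgt invr_gt0 ltr0n.
  apply/seteqP; split => // x /=; apply/negP; rewrite -ltNge.
  exact: lt_le_trans m4_lt0 _.
have {}m40 : 0 < m4 F.
  rewrite lt_neqAle m40 andbT; apply/eqP => m4E.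
  by move: h; rewrite -m4E mulr0 leNgt m20.
rewrite leNgt; apply/negP => k1.
have : kappa * m4 F < m4 F by rewrite gtr_pMl.
by have := m4_le_m2; lra.
Qed.

(** The range of [x] together with [a <= m2] keeps the interval inside [[m1 - 2 m2, m1 + 2 m2]],
    where the increments are bounded below. *)
Lemma mad_family_gap (x a : R) : 0 < a <= m2 ->
  m1 - 2 * m2 <= x <= m1 + m2 ->
  ((a / (B * m2))%:E <= F `]x, (x + a)%R[%classic)%E.
Proof.
move=> /andP[a0 am] /andP[x1 x2]; have m20 : 0 < m2 := m2_gt0 hF.
have -> : a / (B * m2) = (B * m2)^-1 * (x + a - x).
  by rewrite mulrC; congr (_ * _); ring.
apply: prob_itvoo_ge; [by rewrite invr_gt0 mulr_gt0|lra|].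
move=> z /andP[xz za]; apply: (cdf_increments hF); right => /=.
  by rewrite in_itv /= -/m1 -/m2; apply/andP; lra.
by rewrite in_itv /= -/m1 -/m2; apply/andP; lra.
Qed.

Lemma m1_tails (a : R) : 0 < a <= m2 ->
  (F [set x | (m1 + a < x)%R] <= (2^-1 - a / (B * m2))%:E)%E /\
  (F [set x | (x < m1 - a)%R] <= (2^-1 - a / (B * m2))%:E)%E.
Proof.
move=> ha; have /andP[a0 am] := ha; have m20 : 0 < m2 := m2_gt0 hF.
have med := median_is_median (m1_unique hF).
split.
- apply: (prob_tail_le (G := `]m1, (m1 + a)[%classic) (C := [set x | m1 < x])).
  + by apply: measurable_set_bool; exact: measurable_fun_ltr.
  + exact: measurable_itv.
  + by apply: measurable_set_bool; exact: measurable_fun_ltr.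
  + by apply/seteqP; split => x //= [h]; rewrite in_itv /=; lra.
  + by move=> x /= []; rewrite ?in_itv /=; lra.
  + exact: (is_median_gt _ med).
  + by apply: mad_family_gap => //; lra.
- apply: (prob_tail_le (G := `](m1 - a), (m1 - a + a)[%classic)
                       (C := [set x | x < m1])).
  + by apply: measurable_set_bool; exact: measurable_fun_ltr.
  + exact: measurable_itv.
  + by apply: measurable_set_bool; exact: measurable_fun_ltr.
  + by apply/seteqP; split => x //= [h]; rewrite in_itv /=; lra.
  + by move=> x /= []; rewrite ?in_itv /=; lra.
  + exact: (is_median_lt _ med).
  + by apply: mad_family_gap => //; lra.
Qed.

(** A gap on one side of [m1] suffices: just right of [m1 + m2] for the large deviations, just right
    of [m1 - m2] for the small ones. *)
Lemma m2_tails (a : R) : 0 < a <= m2 ->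
  (F [set x | (m2 + a < `|x - m1|)%R] <= (2^-1 - a / (B * m2))%:E)%E /\
  (F [set x | (`|x - m1| < m2 - a)%R] <= (2^-1 - a / (B * m2))%:E)%E.
Proof.
move=> ha; have /andP[a0 am] := ha; have m20 : 0 < m2 := m2_gt0 hF.
have med := median_is_median (m2_unique hF).
have md := measurable_dist m1.
split.
- apply: (prob_tail_le (G := `](m1 + m2), (m1 + m2 + a)[%classic)
                       (C := [set x | m2 < `|x - m1|])).
  + by apply: measurable_set_bool; exact: measurable_fun_ltr.
  + exact: measurable_itv.
  + by apply: measurable_set_bool; exact: measurable_fun_ltr.
  + apply/seteqP; split => x //= [h]; rewrite in_itv /= => hx.
    by move: h; rewrite lter_normr; lra.
  + by move=> x /= []; rewrite ?in_itv /= ?lter_normr; lra.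
  + exact: (is_median_gt _ med).
  + by apply: mad_family_gap => //; lra.
- apply: (prob_tail_le (G := `](m1 - m2), (m1 - m2 + a)[%classic)
                       (C := [set x | `|x - m1| < m2])).
  + by apply: measurable_set_bool; exact: measurable_fun_ltr.
  + exact: measurable_itv.
  + by apply: measurable_set_bool; exact: measurable_fun_ltr.
  + apply/seteqP; split => x //= [h]; rewrite in_itv /= => hx.
    by move: h; rewrite ltr_norml; lra.
  + by move=> x /= []; rewrite ?in_itv /= ?ltr_norml; lra.
  + exact: (is_median_lt _ med).
  + by apply: mad_family_gap => //; lra.
Qed.

End MadFamily.

(** Whichever of [u] and [v] is the minimum [s], the maximum is at least [s ^- 2]. As [delta <= 1]
    makes the logarithm nonnegative, [2 s^2 N] dominates it. *)
Lemma sample_size_exp_le (R : realType) (u v delta N : R) :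
  0 < u -> 0 < v -> 0 < delta <= 1 ->
  2 * Num.max (u ^- 2) (v ^- 2) * ln (6 / delta) <= N ->
  expR (- 2 * Num.min u v ^+ 2 * N) <= delta / 6.
Proof.
move=> u0 v0 /andP[d0 d1] hN; set L := ln _ in hN.
have hd : 1 <= 6 / delta by rewrite ler_pdivlMr //; lra.
have L0 : 0 <= L by exact: ln_ge0.
have -> : delta / 6 = expR (- L).
  by rewrite expRN lnK ?posrE ?invf_div // (lt_le_trans _ hd).
rewrite ler_expR; set s := Num.min u v; set M := Num.max _ _ in hN.
have s0 : 0 < s by rewrite lt_min u0.
have sM : 1 <= s ^+ 2 * M.
  have cancel (x : R) : 0 < x -> x ^- 2 <= M -> 1 <= x ^+ 2 * M.
    move=> x0 xM; apply: (@le_trans _ _ (x ^+ 2 * x ^- 2)).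
      by rewrite mulfV // gt_eqF // exprn_gt0.
    by rewrite ler_pM2l // exprn_gt0.
  rewrite /s; case: (leP u v) => _; apply: cancel => //;
    rewrite le_max lexx ?orbT //.
have s20 : 0 < s ^+ 2 by rewrite exprn_gt0.
have : s ^+ 2 * (2 * M * L) <= s ^+ 2 * N by rewrite ler_pM2l.
have : 0 <= (s ^+ 2 * M - 1) * L by rewrite mulr_ge0 // subr_ge0.
set t := s ^+ 2 in s20 sM *; nra.
Qed.

(** * Contaminated samples *)

(* X_i lies in A only if D_i = 1 or Y_i lies in A; unlike the former, the
   latter events are independent across i, whatever the Z_i are. *)
Definition corrupted_or (R : realType) (A : set R) : set (R * bool) :=
  [set yd : R * bool | yd.2 \/ A yd.1].

Lemma measurable_corrupted_or (R : realType) (A : set (measurableTypeR R)) :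
  measurable A -> measurable (corrupted_or A : set (measurableTypeR R * bool)).
Proof.
move=> mA.
have -> : corrupted_or A = ([set: R] `*` [set true]) `|` (A `*` [set: bool]).
  apply/seteqP; split => [[y b]|[y b]]; rewrite /corrupted_or /=.
    by case => h; [left|right].
  by case => [[_ ->]|[h _]]; [left|right].
by apply: measurableU; apply: measurableX.
Qed.

Section Contamination.
Context (R : realType) (d : measure_display) (T : measurableType d).
Context (P : probability T R) (n : nat) (eps : R).
Context (F : probability (measurableTypeR R) R).
Context (Y : 'I_n -> {RV P >-> measurableTypeR R}).
Context (D : 'I_n -> {RV P >-> bool}).
Hypothesis heps : 0 <= eps <= 1.
Hypothesis hYD : mutually_independent P (fun i w => (Y i w, D i w)).
Hypothesis hY : forall i, has_law (Y i) F.
Hypothesis hD : forall i, has_law (D i) (bernoulli_prob eps).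

Let V (i : 'I_n) (w : T) : measurableTypeR R * bool := (Y i w, D i w).

Let measurable_V i : measurable_fun [set: T] (V i).
Proof. by apply/measurable_fun_pairP; split; exact: measurable_funP. Qed.

(** Ties count as a majority, so the complement is the strict minority that the deterministic bound
    asks for. *)
Definition majority_hits (A : set R) : set T :=
  [set w | (n <= #|hits (fun i => V i @^-1` corrupted_or A) w|.*2)%N].

Lemma measurable_majority_hits (A : set (measurableTypeR R)) :
  measurable A -> measurable (majority_hits A).
Proof.
move=> mA.
apply: (measurable_hits_in [pred J : {set 'I_n} | (n <= #|J|.*2)%N]) => i.
rewrite -[X in measurable X]setTI; apply: measurable_V => //.
exact: measurable_corrupted_or.
Qed.

(** A union bound, valid for any dependence between [Y i] and [D i]. *)
Lemma prob_corrupted_or_le (A : set (measurableTypeR R)) i : measurable A ->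
  (P (V i @^-1` corrupted_or A) <= eps%:E + F A)%E.
Proof.
move=> mA.
have mD : measurable (D i @^-1` [set true]).
  by rewrite -[X in measurable X]setTI; exact: measurable_funP.
have mY : measurable (Y i @^-1` A).
  by rewrite -[X in measurable X]setTI; exact: measurable_funP.
have <- : P (Y i @^-1` A) = F A by exact: hY.
have <- : P (D i @^-1` [set true]) = eps%:E.
  have -> : P (D i @^-1` [set true]) = bernoulli_prob eps [set true].
    exact: hD.
  rewrite bernoulli_probE // !diracE mem_set // memNset //=.
  by rewrite mule1 mule0 adde0.
by apply: (le_trans _ (measureU2 P mD mY)).
Qed.

Lemma prob_majority_hits_le (A : set (measurableTypeR R)) (s : R) :
  measurable A -> 0 <= s -> (F A <= (2^-1 - (eps + s))%:E)%E ->
  (P (majority_hits A) <= (expR (- 2 * s ^+ 2 * n%:R))%:E)%E.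
Proof.
move=> mA s0 FA.
have := prob_majority_le hYD measurable_V (measurable_corrupted_or mA) s0.
rewrite /= card_ord; apply => i.
apply: le_trans (prob_corrupted_or_le i mA) _.
by apply: le_trans (leeD2l _ FA) _; rewrite -EFinD lee_fin; lra.
Qed.

End Contamination.

(** * Choice of the constants and union bound over the four events *)

Theorem lemma20 (R : realType) (tbar B m2bar kappa eps : R)
  (htbar : 0 < tbar < 2^-1) (hB : 0 < B) (hm2bar : 0 < m2bar)
  (hkappa : 0 <= kappa) (heps : 0 < eps < Num.min tbar B^-1)
  (F : probability (measurableTypeR R) R)
  (hF : mad_family F tbar B m2bar kappa)
  (d : measure_display) (T : measurableType d) (P : probability T R) (n : nat)
  (Y : 'I_n -> {RV P >-> measurableTypeR R}) (D : 'I_n -> {RV P >-> bool})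
  (hYD : mutually_independent P (fun i w => (Y i w, D i w)))
  (hY : forall i, has_law (Y i) F)
  (hD : forall i, has_law (D i) (bernoulli_prob eps))
  (Z : 'I_n -> {RV P >-> measurableTypeR R})
  (delta E : R) (hdelta : 0 < delta) (hE : 0 < E)
  (hn : 2 * Num.max (16 * kappa ^+ 2 * B ^+ 2 * m2bar ^+ 2 / E ^+ 2)
                    ((Num.min tbar B^-1 - eps) ^- 2)
        * ln (6 / delta) <= n%:R) :
  let X (i : 'I_n) (w : T) : R :=
    (1 - (D i w)%:R) * Y i w + (D i w)%:R * Z i w in
  ((1 - delta)%:E <=
   P [set w | (`|emp_mad [seq X i w | i : 'I_n] - m2 F|
               <= (1 + 2 * kappa) * B * m2 F * eps + E)%R])%E.
Proof.
pose X (i : 'I_n) (w : T) : R :=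
  (1 - (D i w)%:R) * Y i w + (D i w)%:R * Z i w.
pose good := [set w | `|emp_mad [seq X i w | i : 'I_n] - m2 F|
               <= (1 + 2 * kappa) * B * m2 F * eps + E].
change ((1 - delta)%:E <= P good)%E.
(* For [delta >= 1] the claimed lower bound is nonpositive; otherwise the sample size estimate
   applies. *)
have [d1|d1] := leP 1 delta.
  by apply: le_trans (measure_ge0 _ _); rewrite lee_fin subr_le0.
have [t0 t1] := andP htbar; have [e0 emin] := andP heps.
have m20 : 0 < m2 F := m2_gt0 hF.
have k1 : 1 <= kappa := kappa_ge1 hF.
have k0 : 0 < kappa by lra.
have [et eB] : eps < tbar /\ eps < B^-1 by move: emin; rewrite lt_min => /andP.
(* The inverse squares of [u] and [v] are the two terms of the maximum in [hn]. *)
pose u := E / (4 * kappa * B * m2bar); pose v := Num.min tbar B^-1 - eps.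
have u0 : 0 < u by rewrite /u divr_gt0 // !mulr_gt0.
have v0 : 0 < v by rewrite subr_gt0.
pose s := Num.min u v.
have s0 : 0 < s by rewrite lt_min u0.
have exp_le : expR (- 2 * s ^+ 2 * n%:R) <= delta / 6.
  apply: sample_size_exp_le => //; first by rewrite hdelta ltW.
  rewrite (_ : u ^- 2 = 16 * kappa ^+ 2 * B ^+ 2 * m2bar ^+ 2 / E ^+ 2) //.
  by rewrite /u; field; rewrite !gt_eqF.
pose a := B * m2 F * (eps + s).
have a0 : 0 < a by rewrite !mulr_gt0 // addr_gt0.
have am : a <= m2 F.
  have sB : eps + s <= B^-1.
    have : s <= v by rewrite ge_min lexx orbT.
    have : Num.min tbar B^-1 <= B^-1 by rewrite ge_min lexx orbT.
    by rewrite /v; lra.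
  rewrite /a mulrAC ger_pMl // -(@mulfV _ B) ?gt_eqF // ler_pM2l //.
have aE : a / (B * m2 F) = eps + s.
  by rewrite /a; field; rewrite !gt_eqF.
have bound : 2 * a <= (1 + 2 * kappa) * B * m2 F * eps + E.
  have su : s <= u by rewrite ge_min lexx.
  have Bm : 0 < B * m2 F by rewrite mulr_gt0.
  have hs : 4 * (B * m2 F) * s <= E.
    have -> : E = 4 * kappa * B * m2bar * u.
      by rewrite /u; field; rewrite !gt_eqF.
    (* Here [kappa >= 1] is used, and once more below to replace the coefficient 2 of the [eps] term
       by [1 + 2 kappa]. *)
    have mk : m2 F <= kappa * m2bar.
      by apply: le_trans (m2_le hF) _; rewrite ler_peMl // ltW.
    have : B * m2 F * s <= B * (kappa * m2bar) * u.
      by apply: ler_pM => //; [exact: ltW|exact: ltW|rewrite ler_pM2l].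
    by lra.
  have : 0 <= (kappa - 1) * (B * m2 F * eps).
    by rewrite mulr_ge0 ?subr_ge0 // mulr_ge0 // ltW.
  have : 0 <= B * m2 F * eps by rewrite mulr_ge0 // ltW.
  by rewrite /a; lra.
have ha : 0 < a <= m2 F by rewrite a0.
have [] := m1_tails hB hF ha; rewrite aE => F1 F2.
have [] := m2_tails hB hF ha; rewrite aE => F3 F4.
set A1 := [set x | _] in F1; set A2 := [set x | _] in F2.
set A3 := [set x | _] in F3; set A4 := [set x | _] in F4.
have mdist := @measurable_dist R (m1 F).
have mA1 : measurable A1.
  by apply: measurable_set_bool; exact: measurable_fun_ltr.
have mA2 : measurable A2.
  by apply: measurable_set_bool; exact: measurable_fun_ltr.
have mA3 : measurable A3.
  by apply: measurable_set_bool; exact: measurable_fun_ltr.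
have mA4 : measurable A4.
  by apply: measurable_set_bool; exact: measurable_fun_ltr.
pose bad A := majority_hits Y D A.
have mbad A : measurable A -> measurable (bad A).
  exact: measurable_majority_hits.
have Pbad A : measurable A -> (F A <= (2^-1 - (eps + s))%:E)%E ->
    (P (bad A) <= (delta / 6)%:E)%E.
  move=> mA FA; apply: le_trans (_ : _ <= (expR (- 2 * s ^+ 2 * n%:R))%:E)%E _.
    apply: (prob_majority_hits_le (F := F) (eps := eps)) => //; last exact: ltW.
    by apply/andP; lra.
  by rewrite lee_fin.
have mX i : measurable_fun [set: T] (X i).
  have mD : measurable_fun [set: T] (fun w => (D i w)%:R : R).
    by apply: (measurableT_comp (f := fun b : bool => b%:R : R)).
  apply: measurable_funD; apply: measurable_funM => //.
  - exact: measurable_funB.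
  - exact: (measurable_funP (Y i)).
  - exact: (measurable_funP (Z i)).
have mgood : measurable good.
  apply: measurable_set_bool; apply: measurable_fun_ler => //.
  apply: measurableT_comp => //; apply: measurable_funB => //.
  (* The MAD is the empirical median of the variables [dev i], themselves built from an empirical
     median, so measurability of the latter is used twice. *)
  pose dev i w := `|X i w - emp_median [seq X j w | j : 'I_n]|.
  rewrite (_ : (fun w => _) = fun w => emp_median [seq dev i w | i : 'I_n]).
    apply: measurable_emp_median => i; apply: measurableT_comp => //.
    by apply: measurable_funB => //; exact: measurable_emp_median.
  by apply/funext => w; rewrite /emp_mad -map_comp.
(* An uncorrupted index has [X i w = Y i w], and a corrupted one always counts as a hit, so outside
   [bad A] the observed samples satisfying [p] are a strict minority. *)
have few A (p : pred R) w : (forall x, p x -> A x) -> ~ bad A w ->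
    (#|[pred i | p (X i w)]|.*2 < #|'I_n|)%N.
  move=> pA /negP; rewrite -ltnNge card_ord; apply: leq_ltn_trans.
  rewrite leq_double; apply: subset_leq_card; apply/fintype.subsetP => i.
  rewrite !inE /X => pX; rewrite /corrupted_or /=.
  case: (D i w) pX => /= pX; [by left|right; apply: pA].
  by move: pX; rewrite subr0 mul1r mul0r addr0.
have bad_cover : ~` good `<=` (bad A1 `|` bad A2) `|` (bad A3 `|` bad A4).
  move=> w; apply: contra_notP => /not_orP[/not_orP[b1 b2] /not_orP[b3 b4]].
  apply: le_trans bound.
  apply: (emp_mad_close (m := m1 F)).
  - exact: (few A1 (fun x => m1 F + a < x) w (fun _ => id) b1).
  - exact: (few A2 (fun x => x < m1 F - a) w (fun _ => id) b2).
  - exact: (few A3 (fun x => m2 F + a < `|x - m1 F|) w (fun _ => id) b3).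
  - exact: (few A4 (fun x => `|x - m1 F| < m2 F - a) w (fun _ => id) b4).
have : (P (~` good) <= delta%:E)%E.
  (* Four events at [delta / 6] each cost [2 delta / 3], within the allowed [delta]. *)
  apply: le_trans (_ : _ <= (delta / 6 + delta / 6 + (delta / 6 + delta / 6))%:E)%E _;
    last first.
    by rewrite lee_fin; lra.
  have mU A B' : measurable A -> measurable B' -> measurable (bad A `|` bad B').
    by move=> mA mB; apply: measurableU; exact: mbad.
  apply: (@le_trans _ _ (P ((bad A1 `|` bad A2) `|` (bad A3 `|` bad A4)))).
    apply: le_measure => //; rewrite inE; first exact: measurableC.
    by apply: measurableU; exact: mU.
  rewrite !EFinD; apply: le_trans (measureU2 _ _ _) _; try exact: mU.
  by apply: leeD; apply: le_trans (measureU2 _ _ _) _; rewrite ?leeD //;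
    try exact: mbad; exact: Pbad.
rewrite probability_setC // => h.
rewrite EFinB leeBlDr // addeC -leeBlDr ?fin_num_measure //.
Qed.
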